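(* Let $\mathcal{A}\subseteq\mathcal{X}$ be the unknown unsafe set, and let $\Delta x\ge 0$ be such that every trajectory $x_1,\dots,x_T$ generated by the discrete-time dynamical system $x_{t+1}=f(x_t,u_t,t)$, $u_t\in\mathcal{U}$, satisfies $\Vert x_{t+1}-x_t\Vert\le\Delta x$ for all $t$. Then the set $\mathcal{A}_l$ of learnable guaranteed unsafe states is a subset of the outermost $\Delta x$ shell of the unsafe set: $$\mathcal{A}_l\subseteq\{x\in\mathcal{A}\ |\ -\Delta x\le \mathrm{sd}(x,\mathcal{A})\le 0\}.$$
   Context: Setting. The state space is $\mathcal{X}\subseteq\mathbb{R}^m$ and the control set is $\mathcal{U}$. A discrete-time trajectory is $\xi=(x_1,\dots,x_T;u_1,\dots,u_{T-1})$, where the finite horizon $T$ may vary. There is an unknown unsafe set $\mathcal{A}\subseteq\mathcal{X}$. A trajectory violates the unknown constraint iff $x_t\in\mathcal{A}$ for some $t$; otherwise it is safe. A task $\Pi$ consists of a cost function $c_\Pi$ on state-control trajectories, a start state $x_s$ and a goal state $x_g$. The known constraints are the dynamics $x_{t+1}=f(x_t,u_t,t)$, the control constraints $u_t\in\mathcal{U}$, and $x_1=x_s$, $x_T=x_g$. A (safe, optimal) demonstration $\xi^*$ of $\Pi$ is a minimizer of $c_\Pi$ among all trajectories that satisfy the known constraints and are safe. The unsafe trajectories induced by $\xi^*$ are the trajectories $\xi$ that satisfy the known constraints with $c_\Pi(\xi)<c_\Pi(\xi^* )$ (these necessarily visit $\mathcal{A}$). Learnable guaranteed unsafe states. A candidate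 set $\mathcal{A}'\subseteq\mathcal{X}$ is consistent with a collection of demonstrations and of unsafe trajectories induced by those demonstrations if $\mathcal{A}'$ contains no state of any demonstration in the collection and contains at least one state of each unsafe trajectory in the collection. A state $x$ can be learned guaranteed unsafe if, for some such collection (possibly coming from several tasks sharing the same $\mathcal{A}$, dynamics and control constraints), $x$ belongs to every consistent candidate set. $\mathcal{A}_l$ is the set of all states that can be learned guaranteed unsafe. Signed distance. For $p\in\mathbb{R}^m$ and $\mathcal{S}\subseteq\mathbb{R}^m$, $\mathrm{sd}(p,\mathcal{S})=-\inf_{y\in\partial\mathcal{S}}\Vert p-y\Vert$ if $p\in\mathcal{S}$, and $\mathrm{sd}(p,\mathcal{S})=\inf_{y\in\partial\mathcal{S}}\Vert p-y\Vert$ if $p\in\mathcal{S}^c$. *)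

(* Defs.v *)
From mathcomp Require Import all_boot all_order all_algebra.
From mathcomp Require Import all_classical all_reals all_analysis.

Set Implicit Arguments.
Unset Strict Implicit.
Unset Printing Implicit Defensive.

Import Order.TTheory GRing.Theory Num.Theory.
Import numFieldNormedType.Exports.

Local Open Scope classical_set_scope.
Local Open Scope ring_scope.

(* The library norm on 'rV[R]_m is the sup norm; the two norms induce the same
   topology, so closure and interior below are the Euclidean ones. *)
Definition eucl_norm (R : realType) (m : nat) (v : 'rV[R]_m) : R :=
  Num.sqrt (\sum_(i < m) v ord0 i ^+ 2).

Definition boundary (T : topologicalType) (S : set T) : set T :=
  closure S `\` interior S.

(* The infimum is taken in \bar R, so that it is +oo when the boundary of S is
   empty, i.e. when S is empty or the whole space. *)
Definition boundary_dist (R : realType) (m : nat) (p : 'rV[R]_m)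
    (S : set 'rV[R]_m) : \bar R :=
  ereal_inf [set (eucl_norm (p - y))%:E | y in boundary S].

Definition signed_dist (R : realType) (m : nat) (p : 'rV[R]_m)
    (S : set 'rV[R]_m) : \bar R :=
  if `[< S p >] then (- boundary_dist p S)%E else boundary_dist p S.

(* A trajectory of horizon T = steps + 1 >= 1. Indices are shifted by one:
   state i is x_(i+1) and control i is u_(i+1). *)
Record trajectory (R : realType) (m : nat) (W : Type) := Trajectory {
  steps : nat;
  state : 'I_steps.+1 -> 'rV[R]_m;
  control : 'I_steps -> W }.

Definition cur_state (R : realType) (m : nat) (W : Type)
    (xi : trajectory R m W) (i : 'I_(steps xi)) : 'rV[R]_m :=
  state (widen_ord (leqnSn (steps xi)) i).

Definition next_state (R : realType) (m : nat) (W : Type)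
    (xi : trajectory R m W) (i : 'I_(steps xi)) : 'rV[R]_m :=
  state (lift ord0 i).

(* f is total, but its values outside X and U are irrelevant. The time argument
   is i.+1 since time starts at 1. *)
Definition generated (R : realType) (m : nat) (W : Type)
    (X : set 'rV[R]_m) (U : set W) (f : 'rV[R]_m -> W -> nat -> 'rV[R]_m)
    (xi : trajectory R m W) : Prop :=
  (forall i : 'I_(steps xi).+1, X (state i)) /\
  (forall i : 'I_(steps xi), U (control i) /\
     next_state i = f (cur_state i) (control i) i.+1).

Definition safe (R : realType) (m : nat) (W : Type) (A : set 'rV[R]_m)
    (xi : trajectory R m W) : Prop :=
  forall i : 'I_(steps xi).+1, ~ A (state i).

Record task (R : realType) (m : nat) (W : Type) := Task {
  cost : trajectory R m W -> R;
  start : 'rV[R]_m;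
  goal : 'rV[R]_m }.

Definition known_constraints (R : realType) (m : nat) (W : Type)
    (X : set 'rV[R]_m) (U : set W) (f : 'rV[R]_m -> W -> nat -> 'rV[R]_m)
    (P : task R m W) (xi : trajectory R m W) : Prop :=
  [/\ generated X U f xi,
      state (ord0 : 'I_(steps xi).+1) = start P
    & state (ord_max : 'I_(steps xi).+1) = goal P].

Definition demonstration (R : realType) (m : nat) (W : Type)
    (X : set 'rV[R]_m) (U : set W) (f : 'rV[R]_m -> W -> nat -> 'rV[R]_m)
    (A : set 'rV[R]_m) (P : task R m W) (xi : trajectory R m W) : Prop :=
  [/\ known_constraints X U f P xi, safe A xi
    & forall xi' : trajectory R m W,
        known_constraints X U f P xi' -> safe A xi' -> cost P xi <= cost P xi'].

Definition induced_unsafe (R : realType) (m : nat) (W : Type)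
    (X : set 'rV[R]_m) (U : set W) (f : 'rV[R]_m -> W -> nat -> 'rV[R]_m)
    (P : task R m W) (xi_star xi : trajectory R m W) : Prop :=
  known_constraints X U f P xi /\ cost P xi < cost P xi_star.

(* D is a set of demonstrations, each paired with its task, and N a set of
   unsafe trajectories. *)
Definition consistent (R : realType) (m : nat) (W : Type) (X : set 'rV[R]_m)
    (D : set (task R m W * trajectory R m W)) (N : set (trajectory R m W))
    (A' : set 'rV[R]_m) : Prop :=
  [/\ A' `<=` X,
      forall d, D d -> forall i : 'I_(steps d.2).+1, ~ A' (state i)
    & forall xi, N xi -> exists i : 'I_(steps xi).+1, A' (state i)].

Definition learnable_unsafe (R : realType) (m : nat) (W : Type)
    (X : set 'rV[R]_m) (U : set W) (f : 'rV[R]_m -> W -> nat -> 'rV[R]_m)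
    (A : set 'rV[R]_m) : set 'rV[R]_m :=
  [set x | exists (D : set (task R m W * trajectory R m W))
                  (N : set (trajectory R m W)),
    [/\ forall d, D d -> demonstration X U f A d.1 d.2,
        forall xi, N xi -> exists2 d, D d & induced_unsafe X U f d.1 d.2 xi
      & forall A' : set 'rV[R]_m, consistent X D N A' -> A' x]].

(* Main.v *)
(** The set [A] is itself consistent with the data, so a learnable state [x] lies in
    [A], and [A] without [x] must be inconsistent: some unsafe trajectory in the
    data meets [A] only at [x]. It shares its start state with a safe demonstration,
    so it enters [A] by a step from some [y] outside [A] to [x], of length at most
    [dx]. The segment from [x] to [y] crosses the boundary of [A], within distance
    [dx] of [x]. *)
Require Import Defs.
From mathcomp Require Import all_boot all_order all_algebra.
From mathcomp Require Import all_classical all_reals all_analysis.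

Set Implicit Arguments.
Unset Strict Implicit.
Unset Printing Implicit Defensive.

Import Order.TTheory GRing.Theory Num.Theory.
Import numFieldNormedType.Exports.
Local Open Scope classical_set_scope.
Local Open Scope ring_scope.

Lemma eucl_normZ (R : realType) (m : nat) (a : R) (v : 'rV[R]_m) :
  eucl_norm (a *: v) = `|a| * eucl_norm v.
Proof.
rewrite /eucl_norm -sqrtr_sqr -sqrtrM ?sqr_ge0// mulr_sumr.
by congr Num.sqrt; apply: eq_bigr => i _; rewrite mxE exprMn.
Qed.

(** Connectedness of [[0, 1]]: if the segment missed the boundary, its points in [closure S] would
    be exactly those in [interior S]. Their parameters would form a nonempty clopen subset of
    [[0, 1]], hence all of it, putting [y] in [S]. *)
Lemma segment_meets_boundary (R : realType) (m : nat) (S : set 'rV[R]_m)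
    (x y : 'rV[R]_m) : S x -> ~ S y ->
  exists2 t : R, 0 <= t <= 1 & boundary S (x + t *: (y - x)).
Proof.
move=> Sx nSy; apply: contrapT => nbd.
pose g (t : R) : 'rV[R]_m := x + t *: (y - x).
have cg : continuous g.
  by move=> t; apply: cvgD; [exact: cvg_cst | exact: cvgZr_tmp cvg_id].
have inside t : 0 <= t <= 1 -> closure S (g t) -> interior S (g t).
  move=> t01 clS; apply: contrapT => nint; apply: nbd.
  by exists t.
have g0 : g 0 = x by rewrite /g scale0r addr0.
have g1 : g 1 = y by rewrite /g scale1r addrC subrK.
have full : `[0, 1]%classic `&` g @^-1` (interior S) = `[0, 1]%classic.
  apply: (@segment_connected R 0 1).
  - exists 0; split; first by rewrite /= in_itv /= lexx ler01.
    by apply: inside; rewrite ?lexx ?ler01// g0; exact: subset_closure.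
  - exists (g @^-1` (interior S)) => //.
    by apply: open_comp => [t _|]; [exact: cg | exact: open_interior].
  (* Relative closedness: by [inside], replacing the interior by the closure leaves the trace on
     [[0, 1]] unchanged. *)
  - exists (g @^-1` (closure S)).
      by apply: preimage_closed => [t _|]; [exact: cg | exact: closed_closure].
    apply/seteqP; split=> t /= [t01 St]; split=> //.
      exact/subset_closure/(interior_subset St).
    by apply: inside => //; rewrite in_itv in t01.
apply: nSy; apply: interior_subset; rewrite -g1.
suff [] : (`[0, 1]%classic `&` g @^-1` (interior S)) (1 : R) by [].
by rewrite full /= in_itv /= lexx ler01.
Qed.

(** The boundary point found on the segment lies at distance [t] times that from [x] to [y], with
    [t <= 1]. *)
Lemma boundary_dist_le (R : realType) (m : nat) (S : set 'rV[R]_m)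
    (x y : 'rV[R]_m) : S x -> ~ S y ->
  (boundary_dist x S <= (eucl_norm (x - y))%:E)%E.
Proof.
move=> Sx nSy; have [t /andP[t0 t1] bz] := segment_meets_boundary Sx nSy.
apply: le_trans (ereal_inf_lbound _) _; first by exists (x + t *: (y - x)).
rewrite lee_fin opprD addrA subrr add0r -scalerN opprB eucl_normZ ger0_norm//.
by rewrite ler_piMl// sqrtr_ge0.
Qed.

Lemma boundary_dist_ge0 (R : realType) (m : nat) (S : set 'rV[R]_m)
    (x : 'rV[R]_m) : (0 <= boundary_dist x S)%E.
Proof. by apply: le_ereal_inf_tmp => _ [y _ <-]; rewrite lee_fin sqrtr_ge0. Qed.

(** If no step entered [A], being outside [A] would propagate from the initial state to all later
    ones. *)
Lemma trajectory_enters (R : realType) (m : nat) (W : Type) (A : set 'rV[R]_m)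
    (xi : trajectory R m W) :
  ~ A (state (ord0 : 'I_(steps xi).+1)) -> ~ safe A xi ->
  exists i : 'I_(steps xi), ~ A (cur_state i) /\ A (next_state i).
Proof.
move=> nA0 nsafe; apply: contrapT => nenter; apply: nsafe.
(* The index is split into a natural number and its bound to allow induction. *)
suff H k (hk : (k < (steps xi).+1)%N) : ~ A (state (Ordinal hk)).
  by case=> k hk; exact: H.
elim: k hk => [|k IH] hk.
  by rewrite (_ : Ordinal hk = ord0)//; exact: val_inj.
move=> Ak; apply: nenter; exists (Ordinal (hk : (k < steps xi)%N)); split.
  rewrite /cur_state (_ : widen_ord _ _ = Ordinal (ltnW hk)); first exact: IH.
  exact: val_inj.
by rewrite /next_state (_ : lift _ _ = Ordinal hk)//; exact: val_inj.
Qed.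

(** A safe one would be a cheaper competitor, against optimality of the demonstration. *)
Lemma induced_unsafe_not_safe (R : realType) (m : nat) (W : Type)
    (X : set 'rV[R]_m) (U : set W) (f : 'rV[R]_m -> W -> nat -> 'rV[R]_m)
    (A : set 'rV[R]_m) (P : task R m W) (xi_star xi : trajectory R m W) :
  demonstration X U f A P xi_star -> induced_unsafe X U f P xi_star xi ->
  ~ safe A xi.
Proof.
by move=> [_ _ opt] [kxi lt] sxi; have := opt _ kxi sxi; rewrite leNgt lt.
Qed.

Theorem theorem1 (R : realType) (m : nat) (W : Type)
    (X : set 'rV[R]_m) (U : set W) (f : 'rV[R]_m -> W -> nat -> 'rV[R]_m)
    (A : set 'rV[R]_m) (hA : A `<=` X)
    (dx : R) (dx_ge0 : 0 <= dx)
    (hdx : forall xi : trajectory R m W, generated X U f xi ->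
       forall i : 'I_(steps xi), eucl_norm (next_state i - cur_state i) <= dx) :
  learnable_unsafe X U f A `<=`
    [set x | A x /\ (- dx%:E <= signed_dist x A <= 0)%E].
Proof.
move=> x [D [N [demD indN learn]]].
have hitN xi : N xi -> ~ safe A xi.
  by move=> /indN[d /demD]; exact: induced_unsafe_not_safe.
have safeD d : D d -> safe A d.2 by move=> /demD[].
have Ax : A x.
  apply: learn; split=> // xi /hitN nsafe; apply: contrapT => nhit.
  by apply: nsafe => i Ai; apply: nhit; exists i.
have [xi Nxi only_x] : exists2 xi, N xi &
    forall i : 'I_(steps xi).+1, A (state i) -> state i = x.
  apply: contrapT => none.
  (* Without such a [xi], every unsafe trajectory meets [A] away from [x], so [A] minus [x] would be
     consistent and hence contain [x]. *)
  suff: (A `\ x) x by case=> _; exact.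
  apply: learn; split=> [z [/hA]//|d Dd i [/safeD]|xi Nxi]; first exact.
  apply: contrapT => nhit; apply: none; exists xi => // i Ai.
  by apply: contrapT => ne; apply: nhit; exists i.
have [d Dd [[gen xi0 _] _]] := indN _ Nxi.
have [[_ d0 _] _ _] := demD _ Dd.
have nA0 : ~ A (state (ord0 : 'I_(steps xi).+1)).
  by rewrite xi0 -d0; exact: safeD.
have [i [nAi Ai]] := trajectory_enters nA0 (hitN _ Nxi).
(* Since [x] lies in [A], the signed distance is minus [boundary_dist x A]; what remains is that the
   latter is at most [dx]. *)
split=> //; rewrite /signed_dist asboolT// leeN2 oppe_le0 boundary_dist_ge0 andbT.
apply: le_trans (boundary_dist_le Ax nAi) _.
(* The state entered is [x] itself, so the distance is a step length. *)
by rewrite lee_fin -(only_x _ Ai); exact: hdx.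
Qed.
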